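(* Let $g$ be a semi-discrete holomorphic function with $|g|\ne1$, and for real $\lambda\neq0$ (close to zero) let $n=n^{(\lambda)}$ be the semi-discrete CMC $1$ surface in $\mathbb{S}^{2,1}$ determined by $g$ and $\lambda$. Let $(k,t)$ be a point such that $(k-1,t),(k,t),(k+1,t)$ lie in the domain, and suppose that, for all $\lambda\neq0$ sufficiently close to $0$, this point is a singular point of $n$ with respect to the discrete direction such that $\kappa_{k-1,k}(t)$ and $\kappa_{k,k+1}(t)$ are both finite. Then at least one of the two adjacent edges $[n(k-1,t),n(k,t)]$, $[n(k,t),n(k+1,t)]$ is a singular edge for all $\lambda\neq0$ sufficiently close to $0$.
   Context: Semi-discrete maps are maps $y(k,t)$ on a subdomain of $\mathbb{Z}\times\mathbb{R}$, smooth in $t$; write $y=y(k,t)$, $y_1=y(k+1,t)$, $\partial y=\frac{d}{dt}y$, $\Delta y=y_1-y$. $\mathbb{R}^{3,1}=\{(z_1,z_2,z_3,z_0)\}$ has metric $z_1w_1+z_2w_2+z_3w_3-z_0w_0$ and is identified with Hermitian $2\times2$ matrices by $(z_1,z_2,z_3,z_0)\mapsto\begin{pmatrix} z_0+z_3 & z_1-iz_2 \\ z_1+iz_2 & z_0-z_3 \end{pmatrix}$, so that the squared norm is $-\det$. $\mathbb{H}^3$ is the set of vectors of squared norm $-1$ and $\mathbb{S}^{2,1}$ the set of vectors of squared norm $1$. A semi-discrete holomorphic function is a map $g(k,t)\in\mathbb{C}$ with $\partial g$ and $\Delta g$ never zero and $\dfrac{\partial g\,\partial g_1}{(\Delta g)^2}=\dfrac{\tau(t)}{\sigma(k)}<0$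 for real-valued functions $\tau$ of $t$ and $\sigma$ of $k$. Semi-discrete CMC $1$ surfaces in $\mathbb{S}^{2,1}$: the case $s=-1$ of the Weierstrass-type representation. Set $\mathcal{T}=1-|g|^2\ne0$ (standing genericity assumption), let $\lambda\in\mathbb{R}\setminus\{0\}$ with $1-\lambda\sigma\ne0$, let $E$ be a $\mathrm{GL}_2\mathbb{C}$-valued solution, with $\det E$ real, of $$E^{-1}\Delta E=\begin{pmatrix}0&\Delta g\\ \frac{\lambda\sigma}{\Delta g}&0\end{pmatrix},\qquad E^{-1}\partial E=\begin{pmatrix}0&\partial g\\ \frac{\lambda\tau}{\partial g}&0\end{pmatrix},$$ let $L=\begin{pmatrix}0&\sqrt{\mathcal{T}}\\ \frac{-1}{\sqrt{\mathcal{T}}}&\frac{\overline g}{\sqrt{\mathcal{T}}}\end{pmatrix}$, and set $$x=\frac{\mathrm{sgn}(\mathcal{T})}{\det E}EL(\overline{EL})^t\in\mathbb{H}^3,\qquad n=\frac{\mathrm{sgn}(\mathcal{T})}{\det E}EL\begin{pmatrix}1&0\\0&-1\end{pmatrix}(\overline{EL})^t\in\mathbb{S}^{2,1}.$$ Here $x$ serves as the unit normal of $n$. Principal curvatures of $n$ in the discrete direction: $\kappa_{k,k+1}(t)$ is the scalar with $\Delta x=-\kappa_{k,k+1}(t)\,\Delta n$ on the edge joining $(k,t)$ and $(k+1,t)$. The point $(k,t)$ is called a singular point with respect to the discrete direction if $\kappa_{k-1,k}(t)\kappa_{k,k+1}(t)<0$ or at least one of these two is infinite (i.e. it is a flat,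 parabolic or singular (FPS) point with respect to the discrete direction). The edge $[n,n_1]$ is a singular edge if the plane spanned by $\{\partial n,\Delta n,\partial\Delta n\}$ in $\mathbb{R}^{3,1}$ is not spacelike. *)

(* Defs.v *)
From HB Require Import structures.
From mathcomp Require Import all_boot all_order all_algebra.
From mathcomp Require Import complex.
From mathcomp Require Import all_classical all_reals all_analysis.
From mathcomp Require Import ring.

Set Implicit Arguments.
Unset Strict Implicit.
Unset Printing Implicit Defensive.

Import Order.TTheory GRing.Theory Num.Theory.
Import numFieldNormedType.Exports.

Local Open Scope classical_set_scope.
Local Open Scope complex_scope.
Local Open Scope sesquilinear_scope.
Local Open Scope ring_scope.

Definition mx22 (A : Type) (a b c d : A) : 'M[A]_2 :=
  \matrix_(i < 2, j < 2)
    if i == 0 then (if j == 0 then a else b) else (if j == 0 then c else d).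

(* R^{3,1}: the coordinates (z_1, z_2, z_3, z_0) have column indices 0, 1, 2, 3,
   so the timelike coordinate is the last one. *)
Section Minkowski.
Variable R : realType.
Implicit Types z w : 'rV[R]_4.

Definition mink z w : R :=
  z 0 0 * w 0 0 + z 0 1 * w 0 1 + z 0 2 * w 0 2 - z 0 3 * w 0 3.

Definition herm_of_vec z : 'M[R[i]]_2 :=
  mx22 (z 0 3 + z 0 2)%:C      (z 0 0 -i* z 0 1)
       (z 0 0 +i* z 0 1)       (z 0 3 - z 0 2)%:C.

Definition vec_of_herm (M : 'M[R[i]]_2) : 'rV[R]_4 :=
  \row_(i < 4) [:: complex.Re (M 1 0); complex.Im (M 1 0);
                   (complex.Re (M 0 0) - complex.Re (M 1 1)) / 2;
                   (complex.Re (M 0 0) + complex.Re (M 1 1)) / 2]`_i.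

Lemma herm_of_vecK : cancel herm_of_vec vec_of_herm.
Proof.
move=> z; apply/rowP => i; rewrite !mxE /=.
case: i => -[|[|[|[|//]]]] lt_i /=.
- by congr (z _ _); exact/val_inj.
- by congr (z _ _); exact/val_inj.
- have -> : Ordinal lt_i = 2 by exact/val_inj.
  by field.
- have -> : Ordinal lt_i = 3 by exact/val_inj.
  by field.
Qed.

Lemma vec_of_hermK (M : 'M[R[i]]_2) :
  M^t* = M -> herm_of_vec (vec_of_herm M) = M.
Proof.
move=> hM; have hE i j : (M j i)^*%R = M i j by rewrite -[in RHS]hM !mxE.
have im0 i : complex.Im (M i i) = 0.
  have := hE i i; case: (M i i) => a b [] /= /eqP.
  by rewrite eqNr => /eqP.
apply/matrixP => i j; rewrite !mxE /=.
case: i => -[|[|//]] lt_i; case: j => -[|[|//]] lt_j /=.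
- have -> : Ordinal lt_i = 0 by exact/val_inj.
  have -> : Ordinal lt_j = 0 by exact/val_inj.
  have := im0 0; case: (M 0 0) => a b /= ->.
  by apply/eqP; rewrite eq_complex /= eqxx andbT; apply/eqP; field.
- have -> : Ordinal lt_i = 0 by exact/val_inj.
  have -> : Ordinal lt_j = 1 by exact/val_inj.
  by rewrite -(hE 0 1); case: (M 1 0).
- have -> : Ordinal lt_i = 1 by exact/val_inj.
  have -> : Ordinal lt_j = 0 by exact/val_inj.
  by case: (M 1 0).
- have -> : Ordinal lt_i = 1 by exact/val_inj.
  have -> : Ordinal lt_j = 1 by exact/val_inj.
  have := im0 1; case: (M 1 1) => a b /= ->.
  by apply/eqP; rewrite eq_complex /= eqxx andbT; apply/eqP; field.
Qed.

Lemma mink_det z : (mink z z)%:C = - \det (herm_of_vec z).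
Proof.
rewrite (expand_det_row _ 0) !big_ord_recl big_ord0 /cofactor !det_mx11 !mxE /= /mink; apply/eqP; rewrite eq_complex /=.
by apply/andP; split; apply/eqP; ring.
Qed.

Definition spacelike (U : {vspace 'rV[R]_4}) : Prop :=
  forall v, v \in U -> v != 0 -> 0 < mink v v.

End Minkowski.

Section SemiDiscrete.
Variable R : realType.
Notation C := R[i].

(* R[i] carries no normed R-module structure, so derivatives of C-valued
   functions of a real variable are taken componentwise. *)
Definition cderive (f : R -> C) (t : R) : C :=
  derive1 (fun s => complex.Re (f s)) t +i* derive1 (fun s => complex.Im (f s)) t.

Definition mxderive (F : R -> 'M[C]_2) (t : R) : 'M[C]_2 :=
  \matrix_(i, j) cderive (fun s => F s i j) t.

Definition smooth_on (A : set R) (f : R -> R) : Prop :=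
  forall (m : nat) (t : R), A t -> derivable (derive1n m f) t 1.

Definition smooth_onC (A : set R) (f : R -> C) : Prop :=
  smooth_on A (fun s => complex.Re (f s)) /\
  smooth_on A (fun s => complex.Im (f s)).

Definition Delta (V : zmodType) (y : int -> R -> V) (k : int) (t : R) : V :=
  y (k + 1) t - y k t.

(* A domain in Z x R is given by its slices D k = {t | (k, t) in D}. *)
Definition sd_domain (D : int -> set R) : Prop := forall k, open (D k).

Definition has_edge (D : int -> set R) (k : int) (t : R) : Prop :=
  D k t /\ D (k + 1) t.

Record sd_holomorphic (D : int -> set R) (g : int -> R -> C)
    (sigma : int -> R) (tau : R -> R) : Prop := {
  sdh_smooth : forall k, smooth_onC (D k) (g k);
  sdh_dg_neq0 : forall k t, D k t -> cderive (g k) t != 0;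
  sdh_Dg_neq0 : forall k t, has_edge D k t -> Delta g k t != 0;
  sdh_cross_ratio : forall k t, has_edge D k t ->
    cderive (g k) t * cderive (g (k + 1)) t / (Delta g k t) ^+ 2
      = (tau t / sigma k)%:C /\ tau t / sigma k < 0
}.

(* 1 - lam * sigma <> 0 is only required on edges that occur in the domain. *)
Definition admissible (D : int -> set R) (sigma : int -> R) (lam : R) : Prop :=
  forall k t, has_edge D k t -> 1 - lam * sigma k != 0.

Record frame (D : int -> set R) (g : int -> R -> C)
    (sigma : int -> R) (tau : R -> R) (lam : R)
    (E : int -> R -> 'M[C]_2) : Prop := {
  frame_smooth : forall k i j, smooth_onC (D k) (fun t => E k t i j);
  frame_unit : forall k t, D k t -> E k t \in unitmx;
  frame_det_real : forall k t, D k t -> \det (E k t) \is Num.real;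
  frame_Delta : forall k t, has_edge D k t ->
    invmx (E k t) *m Delta E k t =
      mx22 0 (Delta g k t) ((lam * sigma k)%:C / Delta g k t) 0;
  frame_deriv : forall k t, D k t ->
    invmx (E k t) *m mxderive (E k) t =
      mx22 0 (cderive (g k) t) ((lam * tau t)%:C / cderive (g k) t) 0
}.

(* T = 1 - |g|^2, a real element of R[i]; sqrtC T is the complex square root,
   which is purely imaginary when T < 0. *)
Definition calT (z : C) : C := 1 - `|z| ^+ 2.

Definition matL (z : C) : 'M[C]_2 :=
  mx22 0                      (sqrtC (calT z))
       (- 1 / sqrtC (calT z)) (z^*%R / sqrtC (calT z)).

Definition normal_mx (z : C) (E : 'M[C]_2) : 'M[C]_2 :=
  (Num.sg (calT z) / \det E) *: ((E *m matL z) *m (E *m matL z)^t*).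

Definition surface_mx (z : C) (E : 'M[C]_2) : 'M[C]_2 :=
  (Num.sg (calT z) / \det E) *:
    ((E *m matL z) *m mx22 1 0 0 (- 1) *m (E *m matL z)^t*).

Lemma calT_real (z : C) : calT z \is Num.real.
Proof. by rewrite rpredB ?rpred1 // rpredX // ger0_real. Qed.

Lemma sg_div_det_conj (z : C) (E : 'M[C]_2) : \det E \is Num.real ->
  (Num.sg (calT z) / \det E)^*%R = Num.sg (calT z) / \det E.
Proof.
move=> hE; apply/CrealP; rewrite rpredM ?rpredV //.
by rewrite /Num.sg; case: ifP => _; [|case: ifP => _]; rewrite ?rpred0 ?rpred1 ?rpredN1.
Qed.

Lemma normal_mx_herm (z : C) (E : 'M[C]_2) : \det E \is Num.real ->
  (normal_mx z E)^t* = normal_mx z E.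
Proof.
move=> hE; rewrite /normal_mx; move: (E *m matL z) => B.
by rewrite linearZ /= map_mxZ /= sg_div_det_conj // trmx_mul map_mxM trmxCK.
Qed.

Lemma surface_mx_herm (z : C) (E : 'M[C]_2) : \det E \is Num.real ->
  (surface_mx z E)^t* = surface_mx z E.
Proof.
move=> hE; rewrite /surface_mx; move: (E *m matL z) => B.
have dE : (mx22 1 0 0 (- 1) : 'M[C]_2)^t* = mx22 1 0 0 (- 1).
  by apply/matrixP => i j; rewrite !mxE; case: i => -[|[|//]] ?;
    case: j => -[|[|//]] ? /=; rewrite ?rmorphN ?rmorph0 ?rmorph1.
rewrite linearZ /= map_mxZ /= sg_div_det_conj // 2!trmx_mul 2!map_mxM trmxCK.
by rewrite dE mulmxA.
Qed.

Definition normal_x (g : int -> R -> C) (E : int -> R -> 'M[C]_2)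
  (k : int) (t : R) : 'rV[R]_4 := vec_of_herm (normal_mx (g k t) (E k t)).

Definition surface_n (g : int -> R -> C) (E : int -> R -> 'M[C]_2)
  (k : int) (t : R) : 'rV[R]_4 := vec_of_herm (surface_mx (g k t) (E k t)).

(* The principal curvature of the edge from (k, t) to (k + 1, t), as a relation:
   [Some kappa] is a finite value and [None] is (unsigned) infinity. *)
Definition principal_curvature (x n : int -> R -> 'rV[R]_4) (k : int) (t : R)
    (kappa : option R) : Prop :=
  match kappa with
  | Some c => Delta n k t <> 0 /\ Delta x k t = - c *: Delta n k t
  | None => Delta n k t = 0 /\ Delta x k t <> 0
  end.

Definition finite_curvature (x n : int -> R -> 'rV[R]_4) (k : int) (t : R) :
  Prop := exists c : R, principal_curvature x n k t (Some c).

Definition singular_point (x n : int -> R -> 'rV[R]_4) (k : int) (t : R) :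
    Prop :=
  exists kappa0 kappa1 : option R,
    [/\ principal_curvature x n (k - 1) t kappa0,
        principal_curvature x n k t kappa1
      & match kappa0, kappa1 with
        | Some c0, Some c1 => c0 * c1 < 0
        | _, _ => True
        end].

Definition singular_edge (n : int -> R -> 'rV[R]_4) (k : int) (t : R) : Prop :=
  ~ spacelike
      <<[:: derive1 (n k) t; Delta n k t; derive1 (Delta n k) t]>>%VS.

End SemiDiscrete.

(* Main.v *)
(* Write T = 1 - |g|^2, d = Delta g, s = lam sigma, p = (d, 1)^t and
   e = (0, 1)^t.  The square roots in L cancel, and along an edge
     Delta n = s / ((1 - s) |d|^2 det E)
                 E (- T p p^* + (1 - s) T_1 e e^* ) E^*,
   so <Delta n, Delta n> = s^2 T T_1 / ((1 - s) |d|^2), while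
     Delta x = - (1 + 2 |d|^2 / (s T T_1)) Delta n.
   For small lam the sign of kappa is thus that of lam sigma T T_1.  The two
   edges at (k, t) have sigma of the same sign (opposite to that of tau(t)), so
   a sign change of kappa forces T T_1 < 0 on one of them, and on that edge
   Delta n is timelike.  If T T_1 > 0 on both edges, then no admissible lam
   lies near 0, and the conclusion holds vacuously. *)

Require Import Defs.
From HB Require Import structures.
From mathcomp Require Import all_boot all_order all_algebra.
From mathcomp Require Import complex.
From mathcomp Require Import all_classical all_reals all_analysis.
From mathcomp Require Import ring lra.

Set Implicit Arguments.
Unset Strict Implicit.
Unset Printing Implicit Defensive.

Import Order.TTheory GRing.Theory Num.Theory.
Import numFieldNormedType.Exports.

Local Open Scope classical_set_scope.
Local Open Scope sesquilinear_scope.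
Local Open Scope ring_scope.

(** * Entrywise arithmetic of 2 by 2 matrices *)

Lemma mx22_eta (A : Type) (M : 'M[A]_2) :
  M = mx22 (M 0 0) (M 0 1) (M 1 0) (M 1 1).
Proof.
apply/matrixP => i j; rewrite mxE.
by case: i => -[|[|//]] ?; case: j => -[|[|//]] ? /=; congr (M _ _);
  exact/val_inj.
Qed.

Lemma mx22D (A : nmodType) (a b c d a' b' c' d' : A) :
  mx22 a b c d + mx22 a' b' c' d' = mx22 (a + a') (b + b') (c + c') (d + d').
Proof. by apply/matrixP => i j; rewrite !mxE; do 2?case: ifP. Qed.

Lemma mx22N (A : zmodType) (a b c d : A) :
  - mx22 a b c d = mx22 (- a) (- b) (- c) (- d).
Proof. by apply/matrixP => i j; rewrite !mxE; do 2?case: ifP. Qed.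

Lemma mx22Z (A : pzRingType) (x a b c d : A) :
  x *: mx22 a b c d = mx22 (x * a) (x * b) (x * c) (x * d).
Proof. by apply/matrixP => i j; rewrite !mxE; do 2?case: ifP. Qed.

Lemma mx22_1 (A : pzSemiRingType) : 1%:M = mx22 1 0 0 1 :> 'M[A]_2.
Proof. by rewrite [LHS]mx22_eta !mxE. Qed.

Lemma mx22M (A : pzRingType) (a b c d a' b' c' d' : A) :
  mx22 a b c d *m mx22 a' b' c' d' =
  mx22 (a * a' + b * c') (a * b' + b * d') (c * a' + d * c') (c * b' + d * d').
Proof.
by rewrite [LHS]mx22_eta !mxE !big_ord_recl !big_ord0 !mxE /= !addr0.
Qed.

Lemma det_mx22 (A : comPzRingType) (a b c d : A) :
  \det (mx22 a b c d) = a * d - b * c.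
Proof.
rewrite (expand_det_row _ 0) !big_ord_recl big_ord0 /cofactor !det_mx11 !mxE /=.
ring.
Qed.

Lemma mx22_adj (K : numClosedFieldType) (a b c d : K) :
  (mx22 a b c d)^t* = mx22 a^* c^* b^* d^*.
Proof. by rewrite [LHS]mx22_eta !mxE. Qed.

Lemma det_adj (K : numClosedFieldType) n (M : 'M[K]_n) :
  \det (M^t*) = (\det M)^*.
Proof. by rewrite det_map_mx det_tr. Qed.

(** * Elimination of the square roots in L *)

Section Surface.
Variable R : realType.
Notation C := R[i].
Implicit Types (z d : C) (E M : 'M[C]_2).

Definition realT z : R := 1 - (complex.Re z ^+ 2 + complex.Im z ^+ 2).

Lemma normC2E z : `|z| ^+ 2 = (complex.Re z ^+ 2 + complex.Im z ^+ 2)%:C%C.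
Proof. by rewrite -add_Re2_Im2. Qed.

Lemma calTE z : calT z = (realT z)%:C%C.
Proof. by rewrite /calT normC2E /realT rmorphB rmorph1. Qed.

Lemma calT_conjE z : calT z = 1 - z * z^*.
Proof. by rewrite /calT normCK. Qed.

Lemma realT_neq0 z : `|z| != 1 -> realT z != 0.
Proof.
apply: contra => /eqP T0.
have /eqP : calT z = 0 by rewrite calTE T0.
by rewrite /calT subr_eq0 eq_sym sqrp_eq1.
Qed.

(** Since q^2 = T is real, q q^* = |T| forces q^* = sgn(T) q. This lets the prefactor sgn(T) of x
    and n absorb the conjugated roots. *)
Lemma conj_sqrtC_calT z : calT z != 0 ->
  let q := sqrtC (calT z) in
  Num.sg (calT z) = 1 /\ q^* = q \/ Num.sg (calT z) = -1 /\ q^* = - q.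
Proof.
move=> T0 q.
have q2 : q ^+ 2 = calT z by rewrite sqrtCK.
have q0 : q != 0 by rewrite sqrtC_eq0.
have qq : q * q^* = `|calT z| by rewrite -normCK -normrX q2.
have /orP[T_ge0|T_le0] := calT_real z.
- left; rewrite gtr0_sg ?lt_def ?T0 //; split=> //.
  by apply: (mulfI q0); rewrite qq ger0_norm // -q2.
- right; rewrite ltr0_sg ?lt_def ?(eq_sym 0) ?lt_neqAle ?T0 //; split=> //.
  by apply: (mulfI q0); rewrite qq ler0_norm // -q2 mulrN.
Qed.

(** The Hermitian matrix of n for the identity frame, free of roots; [core_x] plays the same role
    for x. *)
Definition core_n z := mx22 (- calT z) (- z) (- z^*) 1.

Definition core_x z := mx22 (calT z) z z^* ((1 + z * z^*) / calT z).

Lemma sg_matL_surface z : calT z != 0 ->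
  Num.sg (calT z) *: (matL z *m mx22 1 0 0 (- 1) *m (matL z)^t*) = core_n z.
Proof.
move=> T0.
have q0 : sqrtC (calT z) != 0 by rewrite sqrtC_eq0.
have TE : calT z = sqrtC (calT z) ^+ 2 by rewrite sqrtCK.
have -> : core_n z =
  mx22 (- calT z) (- z) (- z^*) ((1 - z * z^*) / calT z).
  by rewrite /core_n -[in (_ - _) / _]calT_conjE divff.
rewrite /matL mx22_adj !mx22M mx22Z !rmorphM !fmorphV !rmorphN /=.
rewrite !rmorph0 !rmorph1 conjCK.
have [[-> ->]|[-> ->]] := conj_sqrtC_calT T0; move: (sqrtC _) q0 TE => q q0 ->;
  congr mx22; by field.
Qed.

Lemma sg_matL_normal z : calT z != 0 ->
  Num.sg (calT z) *: (matL z *m (matL z)^t*) = core_x z.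
Proof.
move=> T0.
have q0 : sqrtC (calT z) != 0 by rewrite sqrtC_eq0.
have TE : calT z = sqrtC (calT z) ^+ 2 by rewrite sqrtCK.
rewrite /core_x /matL mx22_adj !mx22M mx22Z !rmorphM !fmorphV !rmorphN /=.
rewrite !rmorph0 !rmorph1 conjCK.
have [[-> ->]|[-> ->]] := conj_sqrtC_calT T0; move: (sqrtC _) q0 TE => q q0 ->;
  congr mx22; by field.
Qed.

Lemma surface_mxE z E : calT z != 0 ->
  surface_mx z E = (\det E)^-1 *: (E *m core_n z *m E^t*).
Proof.
move=> T0; rewrite /surface_mx trmx_mul map_mxM -(sg_matL_surface T0).
by rewrite -scalemxAr -scalemxAl scalerA (mulrC _^-1) !mulmxA.
Qed.

Lemma normal_mxE z E : calT z != 0 ->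
  normal_mx z E = (\det E)^-1 *: (E *m core_x z *m E^t*).
Proof.
move=> T0; rewrite /normal_mx trmx_mul map_mxM -(sg_matL_normal T0).
by rewrite -scalemxAr -scalemxAl scalerA (mulrC _^-1) !mulmxA.
Qed.

(** * Change of n and x across one edge, as Hermitian matrices *)

Section Edge.
Variables (z d s : C).
Let z1 := z + d.
Hypotheses (d0 : d != 0) (s0 : s != 0) (s1 : 1 - s != 0) (s_real : s^* = s).
Hypotheses (T0 : calT z != 0) (T1 : calT z1 != 0).

Let P := mx22 1 d (s / d) 1.

(** The bracket -T p p^* + (1 - s) T_1 e e^* with its scalar, written out after division by d d^*; E
    and det E are stripped off. *)
Definition core_Dn := (s / (1 - s)) *:
  mx22 (- calT z) (- calT z / d^*) (- calT z / d)
       (((1 - s) * calT z1 - calT z) / (d * d^*)).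

Lemma det_step : \det P = 1 - s.
Proof. by rewrite det_mx22; field. Qed.

(** Factoring E out of both endpoints reduces the step to the frames 1 and P, with det P = 1 - s.
    What remains is a rational identity in z, d, their conjugates and the real s. *)
Lemma core_n_step : (1 - s)^-1 *: (P *m core_n z1 *m P^t*) - core_n z = core_Dn.
Proof.
rewrite /core_Dn /core_n /P !calT_conjE mx22_adj !mx22M !mx22Z mx22N mx22D.
rewrite /z1 !rmorphM !rmorphD !fmorphV /= !rmorph1 s_real.
congr mx22; field; rewrite ?fmorph_eq0 ?d0 ?s1 //.
Qed.

Lemma core_x_step : (1 - s)^-1 *: (P *m core_x z1 *m P^t*) - core_x z =
  - (1 + 2 * (d * d^*) / (s * calT z * calT z1)) *: core_Dn.
Proof.
move: T0 T1.
rewrite /core_Dn /core_x /P !calT_conjE mx22_adj !mx22M !mx22Z mx22N mx22D.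
rewrite /z1 !rmorphM !rmorphD !fmorphV /= !rmorph1 s_real => T0' T1'.
congr mx22; field; rewrite ?fmorph_eq0 ?d0 ?s1 ?T0' ?T1' ?s0 //.
Qed.

(** A sum a p p^* + b e e^* of rank-one terms has determinant a b |det(p, e)|^2, and here det(p, e)
    = d. *)
Lemma det_core_Dn : \det core_Dn =
  - (s ^+ 2 * calT z * calT z1 / ((1 - s) * (d * d^*))).
Proof.
rewrite /core_Dn mx22Z det_mx22; field; rewrite ?fmorph_eq0 ?d0 ?s1 //.
Qed.

Variables (E E1 : 'M[C]_2).
Hypotheses (EP : E1 = E *m P).

Lemma surface_mx_step : surface_mx z1 E1 - surface_mx z E =
  (\det E)^-1 *: (E *m core_Dn *m E^t*).
Proof.
rewrite !surface_mxE // EP det_mulmx det_step invfM trmx_mul map_mxM !mulmxA.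
rewrite -scalerA -scalerBr -core_n_step mulmxBr mulmxBl -scalemxAr -scalemxAl.
by rewrite !mulmxA.
Qed.

Lemma normal_mx_step : normal_mx z1 E1 - normal_mx z E =
  - (1 + 2 * (d * d^*) / (s * calT z * calT z1)) *:
    (surface_mx z1 E1 - surface_mx z E).
Proof.
rewrite surface_mx_step scalerA [X in _ = X *: _]mulrC -scalerA.
rewrite scalemxAl (scalemxAr _ E core_Dn) -core_x_step.
rewrite !normal_mxE // EP det_mulmx det_step invfM trmx_mul map_mxM !mulmxA.
rewrite -scalerA -scalerBr mulmxBr mulmxBl -scalemxAr -scalemxAl.
by rewrite !mulmxA.
Qed.

End Edge.

(** * Transfer of the edge formulas to R^{3,1} *)

Lemma vec_of_hermB M N : vec_of_herm (M - N) = vec_of_herm M - vec_of_herm N.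
Proof.
apply/rowP => i; rewrite !mxE !raddfB /=.
by case: i => -[|[|[|[|//]]]] lt_i /=; ring.
Qed.

Lemma vec_of_hermZ (c : R) M : vec_of_herm (c%:C%C *: M) = c *: vec_of_herm M.
Proof.
have ReM x : complex.Re (c%:C%C * x) = c * complex.Re x.
  by case: x => a b /=; ring.
have ImM x : complex.Im (c%:C%C * x) = c * complex.Im x.
  by case: x => a b /=; ring.
apply/rowP => i; rewrite !mxE !ReM !ImM.
by case: i => -[|[|[|[|//]]]] lt_i /=; ring.
Qed.

Lemma mink_vec_of_herm M : M^t* = M ->
  (mink (vec_of_herm M) (vec_of_herm M))%:C%C = - \det M.
Proof. by move=> hM; rewrite mink_det vec_of_hermK. Qed.

Section EdgeReal.
Variables (g : int -> R -> C) (E : int -> R -> 'M[C]_2) (D : int -> set R).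
Variables (sigma : int -> R) (tau : R -> R) (lam : R) (j : int) (t : R).
Hypotheses (hg : sd_holomorphic D g sigma tau) (hF : frame D g sigma tau lam E).
Hypotheses (hT : forall i u, D i u -> `|g i u| != 1).
Hypotheses (hj : has_edge D j t) (lam0 : lam != 0).
Hypothesis s1 : 1 - lam * sigma j != 0.

Let T := realT (g j t).
Let T1 := realT (g (j + 1) t).
Let s := lam * sigma j.
Let r := complex.Re (Delta g j t) ^+ 2 + complex.Im (Delta g j t) ^+ 2.

Lemma sigma_neq0 : sigma j != 0.
Proof.
have [_] := sdh_cross_ratio hg hj; apply: contraTneq => ->.
by rewrite invr0 mulr0 ltxx.
Qed.

Lemma normDg_gt0 : 0 < r.
Proof.
by rewrite -ltcR -normC2E exprn_gt0 // normr_gt0 (sdh_Dg_neq0 hg hj).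
Qed.

Lemma frame_step : E (j + 1) t =
  E j t *m mx22 1 (Delta g j t) (s%:C%C / Delta g j t) 1.
Proof.
have [h0 _] := hj.
have /(congr1 (mulmx (E j t))) := frame_Delta hF hj.
rewrite mulmxA (mulmxV (frame_unit hF h0)) mul1mx /Delta => /eqP.
rewrite subr_eq => /eqP ->.
rewrite -[X in _ + X]mulmx1 -mulmxDr mx22_1 mx22D.
by rewrite !add0r !addr0.
Qed.

Let d0 : Delta g j t != 0. Proof. exact: (sdh_Dg_neq0 hg hj). Qed.

Let g1 : g (j + 1) t = g j t + Delta g j t.
Proof. by rewrite /Delta addrCA subrr addr0. Qed.

Let realT_vertex i : D i t -> calT (g i t) != 0.
Proof. by move=> hi; rewrite calTE fmorph_eq0 realT_neq0 ?hT. Qed.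

Let s0 : s%:C%C != 0.
Proof. by rewrite fmorph_eq0 mulf_neq0 ?sigma_neq0. Qed.

Let s1c : 1 - s%:C%C != 0.
Proof. by rewrite -(rmorph1 (real_complex R)) -rmorphB fmorph_eq0. Qed.

Let s_real : (s%:C%C)^* = s%:C%C.
Proof. by apply/CrealP; rewrite complex_real. Qed.

Let normDgE : Delta g j t * (Delta g j t)^* = r%:C%C.
Proof. by rewrite -normCK normC2E. Qed.

Lemma Delta_normal_x :
  Delta (normal_x g E) j t =
  - (1 + 2 * r / (s * T * T1)) *: Delta (surface_n g E) j t.
Proof.
have [/realT_vertex T0c /realT_vertex T1c] := hj; rewrite g1 in T1c.
have := normal_mx_step d0 s0 s1c s_real T0c T1c frame_step.
rewrite -g1 normDgE !calTE -/T -/T1 => H.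
rewrite /Delta /normal_x /surface_n -!vec_of_hermB -vec_of_hermZ H.
congr (vec_of_herm (_ *: _)).
move: (s) (T) (T1) (r) => a b c e.
by rewrite !(rmorphN, rmorphD, rmorph1, rmorphM, fmorphV).
Qed.

(** Congruence by E multiplies the determinant by |det E|^2, which cancels the factor (det E)^-2
    because det E is real. The frame thus drops out of the norm. *)
Lemma mink_Delta_surface_n :
  mink (Delta (surface_n g E) j t) (Delta (surface_n g E) j t) =
  s ^+ 2 * T * T1 / ((1 - s) * r).
Proof.
have [h0 h1] := hj.
have T0c := realT_vertex h0; have T1c := realT_vertex h1; rewrite g1 in T1c.
have := surface_mx_step d0 s1c s_real T0c T1c frame_step.
rewrite -g1 => H.
apply: complexI.
rewrite /Delta /surface_n -!vec_of_hermB mink_vec_of_herm; last first.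
  by rewrite linearB /= map_mxB !surface_mx_herm ?(frame_det_real hF).
rewrite H detZ !det_mulmx det_adj det_core_Dn // -g1 normDgE !calTE -/T -/T1.
have /CrealP -> := frame_det_real hF h0.
have E0 : \det (E j t) != 0 by rewrite -unitfE -unitmxE (frame_unit hF).
have r0 : r%:C%C != 0 by rewrite fmorph_eq0 gt_eqF // normDg_gt0.
move: s1c r0; move: (s) (T) (T1) (r) => a b c e a1 e0.
rewrite !(rmorphM, fmorphV, rmorphXn, rmorphB, rmorph1) /=.
field; by rewrite E0 a1 e0.
Qed.

End EdgeReal.

(** The span contains Delta n, which is nonzero as soon as its norm is negative. *)
Lemma singular_edge_timelike (n : int -> R -> 'rV[R]_4) j t :
  mink (Delta n j t) (Delta n j t) < 0 -> singular_edge n j t.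
Proof.
move=> lt0 sp; have : 0 < mink (Delta n j t) (Delta n j t).
  apply: sp; first by rewrite memv_span // !inE eqxx orbT.
  by apply: contraTneq lt0 => ->; rewrite /mink !mxE !mul0r !addr0 subrr ltxx.
by rewrite ltNge ltW.
Qed.

End Surface.

(** * Signs of the curvatures for small lambda *)

Lemma mul_1Ddiv_gt0 (R : realFieldType) (a b x : R) : 0 < a * b ->
  x != 0 -> `|x| < `|a| -> `|x| < `|b| -> 0 < (1 + a / x) * (1 + b / x).
Proof.
move=> ab x0 xa xb.
have px : 0 < `|x| by rewrite normr_gt0.
have u1 : 1 < `|a / x| by rewrite normrM normfV ltr_pdivlMr ?mul1r.
have v1 : 1 < `|b / x| by rewrite normrM normfV ltr_pdivlMr ?mul1r.
have uv : 0 < (a / x) * (b / x).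
  by rewrite mulrACA -invfM pmulr_rgt0 // invr_gt0 -expr2 exprn_even_gt0.
(* Both quotients exceed 1 in absolute value and share a sign, so adding 1 changes neither sign. *)
move: (a / x) (b / x) u1 v1 uv => u v.
by rewrite !lter_normr => /orP[] ? /orP[] ? ?; nra.
Qed.

(** Turns the curvature relation into a computed value: a nonzero Delta n excludes infinity and
    determines the scalar. *)
Lemma principal_curvature_uniq (R : realType) (x n : int -> R -> 'rV[R]_4)
    (j : int) (t c : R) (kappa : option R) :
  Delta n j t != 0 -> Delta x j t = - c *: Delta n j t ->
  principal_curvature x n j t kappa -> kappa = Some c.
Proof.
move=> n0 xE; case: kappa => [c'|] /= [n0' xE'].
- congr Some; apply/oppr_inj/eqP; rewrite -subr_eq0.
  have : (- c' - - c) *: Delta n j t == 0 by rewrite scalerBl -xE -xE' subrr.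
  by rewrite scaler_eq0 (negPf n0) orbF.
- by rewrite n0' eqxx in n0.
Qed.

Theorem theorem5p5 (R : realType) (D : int -> set R)
  (g : int -> R -> R[i]) (sigma : int -> R) (tau : R -> R)
  (E : R -> int -> R -> 'M[R[i]]_2) (k : int) (t : R)
  (hD : sd_domain D)
  (hg : sd_holomorphic D g sigma tau)
  (hT : forall j s, D j s -> `|g j s| != 1)
  (hE : \forall lam \near (0 : R)^', admissible D sigma lam ->
          frame D g sigma tau lam (E lam))
  (hk0 : D (k - 1) t) (hk1 : D k t) (hk2 : D (k + 1) t)
  (hsing : \forall lam \near (0 : R)^', admissible D sigma lam ->
     let x := normal_x g (E lam) in
     let n := surface_n g (E lam) in
     [/\ singular_point x n k t,
         finite_curvature x n (k - 1) t
       & finite_curvature x n k t]) :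
  (\forall lam \near (0 : R)^', admissible D sigma lam ->
     singular_edge (surface_n g (E lam)) (k - 1) t) \/
  (\forall lam \near (0 : R)^', admissible D sigma lam ->
     singular_edge (surface_n g (E lam)) k t).
Proof.
have hk0' : has_edge D (k - 1) t by split; rewrite ?subrK.
have hk1' : has_edge D k t by split.
(* The product T T_1 on edge j; it decides the causal type of Delta n for small lambda. *)
pose P j := realT (g j t) * realT (g (j + 1) t).
have P0 j : has_edge D j t -> P j != 0.
  by case=> h0 h1; rewrite mulf_neq0 ?realT_neq0 ?(hT _ t).
(* Positivity, not just nonvanishing, is what fixes the sign of the norm of Delta n; |lam| < 1 /
   |sigma j| suffices. *)
have near_edge j : has_edge D j t ->
    \forall lam \near (0 : R)^', 0 < 1 - lam * sigma j.
  move=> hj; have s0 := sigma_neq0 hg hj.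
  near=> lam.
  rewrite subr_gt0 (le_lt_trans (ler_norm _)) // normrM.
  rewrite -ltr_pdivlMr ?normr_gt0 //.
  by near: lam; apply: dnbhs0_lt; rewrite mul1r invr_gt0 normr_gt0.
have timelike j : has_edge D j t -> P j < 0 ->
    \forall lam \near (0 : R)^', admissible D sigma lam ->
      singular_edge (surface_n g (E lam)) j t.
  move=> hj Pj; near=> lam => adm; apply: singular_edge_timelike.
  have lam0 : lam != 0 by near: lam; exact: nbhs_dnbhs_neq.
  have s1 : 0 < 1 - lam * sigma j by near: lam; exact: near_edge.
  have hF : frame D g sigma tau lam (E lam) by move: adm; near: lam.
  rewrite (mink_Delta_surface_n hg hF hT hj (lt0r_neq0 s1)).
  rewrite pmulr_llt0 ?invr_gt0 ?mulr_gt0 ?(normDg_gt0 hg hj) //.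
  rewrite -mulrA pmulr_rlt0 // exprn_even_gt0 //=.
  by rewrite mulf_neq0 ?(sigma_neq0 hg hj).
(* [P] does not involve lambda, so the same edge serves all small lambda. *)
have [Pk0|Pk0] := ltP (P (k - 1)) 0; first by left; exact: timelike.
have [Pk1|Pk1] := ltP (P k) 0; first by right; exact: timelike.
(* Either side would do: every admissible small lambda will be refuted. *)
left.
pose r j := complex.Re (Delta g j t) ^+ 2 + complex.Im (Delta g j t) ^+ 2.
(* Chosen so that the curvature of edge j is 1 + A j / lam. *)
pose A j := 2 * r j / (sigma j * P j).
have sig0 := sigma_neq0 hg hk0'; have sig1 := sigma_neq0 hg hk1'.
have Pk0' : 0 < P (k - 1) by rewrite lt_def Pk0 P0.
have Pk1' : 0 < P k by rewrite lt_def Pk1 P0.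
have r0 : 0 < r (k - 1) := normDg_gt0 hg hk0'.
have r1 : 0 < r k := normDg_gt0 hg hk1'.
have sig01 : 0 < sigma (k - 1) * sigma k.
  have [_ t0] := sdh_cross_ratio hg hk0'.
  have [_ t1] := sdh_cross_ratio hg hk1'.
  (* Both cross-ratios are negative with the same tau(t); their product is tau(t)^2 over the product
     of the sigmas. *)
  have tt : 0 < (tau t / sigma (k - 1)) * (tau t / sigma k).
    by rewrite nmulr_rgt0.
  have tau0 : tau t != 0 by apply: contraTneq t0 => ->; rewrite mul0r ltxx.
  move: tt; rewrite mulrACA -invfM pmulr_rgt0 ?invr_gt0 //.
  by rewrite -expr2 exprn_even_gt0.
have A01 : 0 < A (k - 1) * A k.
  have -> : A (k - 1) * A k =
      4 * (r (k - 1) * r k) / (sigma (k - 1) * sigma k * (P (k - 1) * P k)).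
    rewrite /A; field; by rewrite sig0 sig1 !gt_eqF.
  apply: divr_gt0; first by rewrite !mulr_gt0.
  by rewrite pmulr_rgt0 // mulr_gt0.
have [A0 A1] : A (k - 1) != 0 /\ A k != 0.
  by apply/andP; rewrite -negb_or -mulf_eq0 gt_eqF.
pose x lam := normal_x g (E lam); pose n lam := surface_n g (E lam).
near=> lam => adm; exfalso.
have lam0 : lam != 0 by near: lam; exact: nbhs_dnbhs_neq.
have hF : frame D g sigma tau lam (E lam) by move: adm; near: lam.
have curv j : has_edge D j t -> 0 < 1 - lam * sigma j ->
    forall kappa, principal_curvature (x lam) (n lam) j t kappa ->
    kappa = Some (1 + A j / lam).
  move=> hj s1 kappa; apply: principal_curvature_uniq.
    (* Delta n is nonzero because its norm is. *)
    have : mink (Delta (n lam) j t) (Delta (n lam) j t) != 0.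
      rewrite (mink_Delta_surface_n hg hF hT hj (lt0r_neq0 s1)).
      rewrite -(mulrA (_ ^+ 2)).
      apply: mulf_neq0.
        apply: mulf_neq0 (P0 _ hj).
        by rewrite expf_neq0 ?mulf_neq0 ?(sigma_neq0 hg hj).
      by rewrite invr_neq0 // lt0r_neq0 // mulr_gt0 // (normDg_gt0 hg hj).
    by apply: contra_neq => ->; rewrite /mink !mxE !mul0r !addr0 subrr.
  rewrite /x (Delta_normal_x hg hF hT hj lam0 (lt0r_neq0 s1)).
  congr (- (1 + _) *: _).
  by rewrite /A -[RHS]mulrA -invfM; congr (_ / _); rewrite /P; ring.
have s0 : 0 < 1 - lam * sigma (k - 1) by near: lam; exact: near_edge.
have s1 : 0 < 1 - lam * sigma k by near: lam; exact: near_edge.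
have [[kappa0 [kappa1 [h0 h1 +]]] _ _] : [/\
    singular_point (x lam) (n lam) k t,
    finite_curvature (x lam) (n lam) (k - 1) t
  & finite_curvature (x lam) (n lam) k t].
  by move: adm; near: lam.
rewrite (curv _ hk0' s0 _ h0) (curv _ hk1' s1 _ h1).
(* Once |lam| is below both |A (k - 1)| and |A k|, the curvatures have the sign of A / lam, common
   to both edges, so their product cannot be negative. *)
apply/negP; rewrite -leNgt ltW // mul_1Ddiv_gt0 //.
  by near: lam; apply: dnbhs0_lt; rewrite normr_gt0.
by near: lam; apply: dnbhs0_lt; rewrite normr_gt0.
Unshelve. all: by end_near.
Qed.
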